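(* Let $(x^k,y^k)$ be a sequence generated by the primal-dual algorithm with linesearch (PDAL) described in the context, applied to the saddle point problem $\min_{x\in X}\max_{y\in Y}\langle Kx,y\rangle+g(x)-f^*(y)$. Then $(x^k,y^k)$ is a bounded sequence in $X\times Y$ and all its cluster points are solutions (saddle points) of this problem. Moreover, if the restriction $g|_{\operatorname{dom} g}$ of $g$ to its effective domain is continuous and $(\tau_k)$ is bounded from above, then the whole sequence $(x^k,y^k)$ converges to a solution of the problem.
   Context: Setting: $X,Y$ are finite-dimensional real inner product spaces with norms $\|\cdot\|=\sqrt{\langle\cdot,\cdot\rangle}$; $K\colon X\to Y$ is linear with adjoint $K^*$; $g\colon X\to(-\infty,+\infty]$ and $f^*\colon Y\to(-\infty,+\infty]$ are proper lower semicontinuous convex functions ($f^*$ is the Legendre–Fenchel conjugate of a convex lower semicontinuous function $f$). A solution (saddle point) is a pair $(\hat x,\hat y)\in \operatorname{dom} g\times\operatorname{dom} f^*$ with $g(x)-g(\hat x)+\langle K^*\hat y,x-\hat x\rangle\ge 0$ for all $x\in X$ and $f^*(y)-f^*(\hat y)-\langle K\hat x,y-\hat y\rangle\ge 0$ for all $y\in Y$. It is assumed that a saddle point exists. $\operatorname{prox}_h(x)=\operatorname{argmin}_z\{h(z)+\frac12\|z-x\|^2\}$. PDAL. Initialization: choose $x^0\in X$, $y^1\in Y$, $\tau_0>0$, $\mu\in(0,1)$, $\delta\in(0,1)$, $\beta>0$; set $\theta_0=1$. For $k=1,2,\dots$: 1. $x^k=\operatorname{prox}_{\tau_{k-1}g}(x^{k-1}-\tau_{k-1}K^*y^k)$.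 2. Choose any trial value $\tau_k\in[\tau_{k-1},\tau_{k-1}\sqrt{1+\theta_{k-1}}]$ and run the linesearch: 2.a. compute $\theta_k=\tau_k/\tau_{k-1}$, $\bar x^k=x^k+\theta_k(x^k-x^{k-1})$, $y^{k+1}=\operatorname{prox}_{\beta\tau_kf^*}(y^k+\beta\tau_kK\bar x^k)$; 2.b. if $\sqrt\beta\,\tau_k\|K^*y^{k+1}-K^*y^k\|\le\delta\|y^{k+1}-y^k\|$, stop the linesearch (keeping the current $\tau_k,\theta_k,\bar x^k,y^{k+1}$); otherwise replace $\tau_k$ by $\mu\tau_k$ and return to 2.a. *)

(* Defs.v *)
From HB Require Import structures.
From mathcomp Require Import all_boot all_order all_algebra.
From mathcomp Require Import all_classical all_reals all_analysis.

Set Implicit Arguments.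
Unset Strict Implicit.
Unset Printing Implicit Defensive.

Import Order.TTheory GRing.Theory Num.Theory.
Import numFieldNormedType.Exports.

Local Open Scope classical_set_scope.
Local Open Scope ring_scope.

(* Finite-dimensional real inner product spaces.  [Vector] provides finite
   dimensionality; [norm_inner] says that the norm, hence the topology, of the
   underlying normed module is the one induced by the inner product. *)
HB.mixin Record NormedVector_isEuclidean (R : realType) V
    & NormedModule R V & Vector R V := {
  inner : {dot V for (@idfun R)} ;
  norm_inner : forall x : V, `|x| = Num.sqrt (inner x x)
}.

#[short(type="euclideanType")]
HB.structure Definition Euclidean (R : realType) :=
  {V of NormedVector_isEuclidean R V & NormedModule R V & Vector R V}.

Definition adjoint_of (R : realType) (X Y : euclideanType R)
    (K : X -> Y) (Ka : Y -> X) : Prop :=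
  forall x y, inner (K x) y = inner x (Ka y).

Section ConvexAnalysis.
Context {R : realType} {V : euclideanType R}.
Implicit Types (h : V -> \bar R) (x p : V).
Local Open Scope ereal_scope.

Definition effective_domain h : set V := [set x | h x < +oo].

Definition proper_ereal h : Prop := (forall x, -oo < h x) /\ effective_domain h !=set0.

(* For functions with values in ]-oo, +oo], so that no sum [+oo + -oo] occurs
   on the right-hand side of the inequality. *)
Definition convex_ereal h : Prop :=
  (forall x, -oo < h x) /\
  forall x y (t : R), (0 < t < 1)%R ->
    h (t *: x + (1 - t) *: y)%R <= t%:E * h x + (1 - t)%:E * h y.

Definition fenchel_conjugate h : V -> \bar R :=
  fun y => ereal_sup (range (fun x => (inner y x)%:E - h x)).

Definition is_argmin h p : Prop := forall z, h p <= h z.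

(* [is_prox h x p] reads p = prox_h(x). *)
Definition is_prox h x p : Prop :=
  is_argmin (fun z => h z + (2^-1 * `|z - x| ^+ 2)%:E) p.

End ConvexAnalysis.

Section SaddlePoint.
Context {R : realType} {X Y : euclideanType R}.
Variables (K : X -> Y) (Ka : Y -> X) (g : X -> \bar R) (fs : Y -> \bar R).
Local Open Scope ereal_scope.

Definition saddle_point (z : X * Y) : Prop :=
  [/\ effective_domain g z.1, effective_domain fs z.2,
    (forall x, 0 <= g x - g z.1 + (inner (Ka z.2) (x - z.1))%:E)
    & (forall y, 0 <= fs y - fs z.2 - (inner (K z.1) (y - z.2))%:E)].

End SaddlePoint.

Section PDAL.
Context {R : realType} {X Y : euclideanType R}.
Variables (K : X -> Y) (Ka : Y -> X) (g : X -> \bar R) (fs : Y -> \bar R).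
Variables (mu delta beta : R).

Section Linesearch.
(* x^{k-1}, x^k, y^k and tau_{k-1} *)
Variables (x0 x1 : X) (y1 : Y) (tau0 : R).

(* Step 2.a with trial value t: y2 is the candidate for y^{k+1}. *)
Definition trial_step (t : R) (y2 : Y) : Prop :=
  let xbar := x1 + (t / tau0) *: (x1 - x0) in
  is_prox (fun y => (beta * t)%:E * fs y)%E (y1 + (beta * t) *: K xbar) y2.

(* The test of step 2.b. *)
Definition accept (t : R) (y2 : Y) : Prop :=
  Num.sqrt beta * t * `|Ka y2 - Ka y1| <= delta * `|y2 - y1|.

(* Started from the trial value t, the loop terminates with step size t' and
   y^{k+1} = y2 exactly when [linesearch t t' y2] holds. *)
Inductive linesearch (t : R) : R -> Y -> Prop :=
| linesearch_stop y2 :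
    trial_step t y2 -> accept t y2 -> linesearch t t y2
| linesearch_retry y2 t' y2' :
    trial_step t y2 -> ~ accept t y2 -> linesearch (mu * t) t' y2' ->
    linesearch t t' y2'.

End Linesearch.

(* Fields quantified over k describe iteration k+1.  The dual iterates are
   indexed from 1: y 0 plays no role. *)
Record is_PDAL (x : nat -> X) (y : nat -> Y) (tau theta : nat -> R) : Prop := {
  PDAL_tau0 : 0 < tau 0%N ;
  PDAL_theta0 : theta 0%N = 1 ;
  PDAL_x : forall k,
    is_prox (fun u => (tau k)%:E * g u)%E (x k - tau k *: Ka (y k.+1)) (x k.+1) ;
  PDAL_linesearch : forall k, exists t : R,
    tau k <= t <= tau k * Num.sqrt (1 + theta k) /\
    linesearch (x k) (x k.+1) (y k.+1) (tau k) t (tau k.+1) (y k.+2) ;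
  PDAL_theta : forall k, theta k.+1 = tau k.+1 / tau k
}.

End PDAL.

(* Main.v *)
(** Adding the prox inequalities of x^{k+1} and y^{k+1} to the one of x^k, tested
    at x^{k+1} and at x^{k-1}, the linesearch test absorbs the coupling term and
    shows that, for a saddle point (xh, yh) with primal gap P,
      |x^k - xh|^2 + |y^k - yh|^2 / beta + 2 tau_{k-1} (1 + theta_{k-1}) P(x^{k-1})
    decreases by at least |xbar^k - x^k|^2
      + (1 - delta) (|xbar^k - x^{k+1}|^2 + |y^{k+1} - y^k|^2 / beta).
    Hence the iterates are bounded and their increments vanish; as the steps are
    bounded below, the prox inequalities pass to the limit at any cluster point.
    With that cluster point as (xh, yh), the decreasing quantity tends to 0 along
    a subsequence when P is continuous on dom g, hence tends to 0. *)

Require Import Defs.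
From HB Require Import structures.
From mathcomp Require Import all_boot all_order all_algebra.
From mathcomp Require Import all_classical all_reals all_analysis.
From mathcomp Require Import ring lra.

Set Implicit Arguments.
Unset Strict Implicit.
Unset Printing Implicit Defensive.

Import Order.TTheory GRing.Theory Num.Theory.
Import numFieldNormedType.Exports.
Import VectorInternalTheory.

Local Open Scope classical_set_scope.
Local Open Scope ring_scope.

(** * Calculus of the inner product, Cauchy-Schwarz and polarization *)

Section InnerProduct.
Context {R : realType} {V : euclideanType R}.
Implicit Types (u v w : V) (a : R).

Lemma innerC u v : inner u v = inner v u.
Proof. by have := hermC (@inner R V) u v; rewrite expr0 mul1r. Qed.

Lemma innerDl u v w : inner (u + v) w = inner u w + inner v w.
Proof. exact: linearDl. Qed.

Lemma inner0l w : inner 0 w = 0.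
Proof. exact: linear0l. Qed.

Lemma innerZl a u w : inner (a *: u) w = a * inner u w.
Proof. exact: linearZl_LR. Qed.

Lemma innerNl u w : inner (- u) w = - inner u w.
Proof. by rewrite -scaleN1r innerZl mulN1r. Qed.

Lemma innerDr u v w : inner w (u + v) = inner w u + inner w v.
Proof. by rewrite innerC innerDl !(innerC w). Qed.

Lemma innerZr a u w : inner w (a *: u) = a * inner w u.
Proof. by rewrite innerC innerZl innerC. Qed.

Lemma innerNr u w : inner w (- u) = - inner w u.
Proof. by rewrite innerC innerNl innerC. Qed.

Definition innerE := (innerDl, innerDr, innerNl, innerNr, innerZl, innerZr).

Lemma inner_ge0 u : 0 <= inner u u.
Proof.
have [->|u0] := eqVneq u 0; first by rewrite inner0l.
exact/ltW/(neq0_dnorm_gt0 (s := @inner R V)).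
Qed.

Lemma sqr_norm_inner u : `|u| ^+ 2 = inner u u.
Proof. by rewrite norm_inner sqr_sqrtr// inner_ge0. Qed.

Lemma sqr_normB u v : `|u - v| ^+ 2 = `|u| ^+ 2 - 2 * inner u v + `|v| ^+ 2.
Proof. by rewrite !sqr_norm_inner !innerE (innerC v u); ring. Qed.

(** Cauchy-Schwarz by squaring the triangle inequality, which the normed module structure already
    provides. *)
Lemma inner_le_norm u v : inner u v <= `|u| * `|v|.
Proof.
have := ler_normB u (- v); rewrite normrN.
move=> /(lerXn2r 2 (normr_ge0 _) (addr_ge0 (normr_ge0 _) (normr_ge0 _))).
rewrite sqr_normB normrN innerNr; lra.
Qed.

Lemma normr_inner_le u v : `|inner u v| <= `|u| * `|v|.
Proof.
by rewrite ler_norml inner_le_norm andbT lerNl -innerNl -(normrN u) inner_le_norm.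
Qed.

(** Polarization expresses the inner product through norms, so its joint continuity reduces to that
    of the norm. *)
Lemma cvg_inner {T : Type} {F : set_system T} {FF : Filter F} (f h : T -> V) u v :
  f @ F --> u -> h @ F --> v -> inner (f t) (h t) @[t --> F] --> inner u v.
Proof.
move=> fu hv.
have polar (a b : V) :
    inner a b = 2^-1 * (`|a| * `|a| + `|b| * `|b| - `|a - b| * `|a - b|).
  by rewrite -!expr2 sqr_normB; field.
rewrite polar; under eq_fun do rewrite polar.
apply: cvgM; first exact: cvg_cst.
by apply: cvgB; [apply: cvgD|]; apply: cvgM; apply: cvg_norm => //; apply: cvgB.
Qed.

End InnerProduct.

(** * Bounded linear maps and compactness in finite dimension *)

Section FiniteDimension.
Context {R : realType}.

(* The Gram matrix of a basis is invertible, so coordinates are linear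
   combinations of inner products with the basis vectors. *)
Lemma v2r_bounded (V : euclideanType R) :
  exists2 C : R, 0 < C & forall v : V, `|v2r v| <= C * `|v|.
Proof.
pose r : {linear 'rV[R]_(dim V) -> V} := r2v; pose b i := r 'e_i.
have rE (u : 'rV[R]_(dim V)) : r u = \sum_i u 0 i *: b i.
  rewrite [in LHS](row_sum_delta u) linear_sum; apply: eq_bigr => i _.
  by rewrite linearZ.
have inner_suml (I : finType) (F : I -> V) w :
    inner (\sum_i F i) w = \sum_i inner (F i) w.
  apply: (big_morph (fun u => inner u w)) => [u v|]; first exact: innerDl.
  exact: inner0l.
pose G : 'M[R]_(dim V) := \matrix_(i, j) inner (b i) (b j).
have mulG (u : 'rV[R]_(dim V)) j : (u *m G) 0 j = inner (r u) (b j).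
  rewrite mxE rE inner_suml; apply: eq_bigr => i _.
  by rewrite mxE innerZl.
(* If [u *m G = 0], then [r u] is orthogonal to every [b j], hence to itself, so [r u = 0] and
   [u = 0]. *)
have Gu : G \in unitmx.
  rewrite -row_free_unit -kermx_eq0; apply/eqP/row_matrixP => i.
  rewrite row0; set u := row i _.
  have uG : u *m G = 0 by rewrite -row_mul mulmx_ker row0.
  apply: (can_inj (@r2vK _ V)); rewrite linear0; apply/eqP/negPn/negP => u0.
  have := neq0_dnorm_gt0 (s := @inner R V) _ u0.
  rewrite {1}rE inner_suml big1 ?ltxx// => j _.
  by rewrite innerZl innerC -mulG uG [X in _ * X]mxE mulr0.
pose C := \sum_i \sum_j `|b i| * `|invmx G i j|.
have C0 : 0 <= C by do 2! (apply: sumr_ge0 => ? _); rewrite mulr_ge0.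
(* The summand 1 keeps the constant positive even in dimension 0, where [C] is an empty sum. *)
exists (1 + C) => [|v]; first by rewrite ltr_wpDr.
apply: (@le_trans _ _ (C * `|v|)); last by rewrite ler_wpM2r// lerDr.
rewrite [leLHS]/Num.Def.normr/= mx_normrE; apply/bigmax_leP; split=> [|[i k] _ /=].
  by rewrite mulr_ge0// normr_ge0.
have -> : v2r v = (\row_j inner v (b j)) *m invmx G.
  apply: (can_inj (mulmxK Gu)); rewrite mulmxKV//.
  by apply/rowP => j; rewrite mulG /r/= v2rK mxE.
rewrite (ord1 i) mxE (le_trans (ler_norm_sum _ _ _))//.
rewrite mulr_suml; apply: ler_sum => j _; rewrite (bigD1 k)//= mulrDl ler_wpDr//.
  by rewrite mulr_ge0 ?normr_ge0//; apply: sumr_ge0 => ? _; rewrite mulr_ge0.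
by rewrite mxE normrM mulrAC ler_wpM2r// mulrC normr_inner_le.
Qed.

Lemma linear_rV_bounded (V : normedModType R) n (f : {linear 'rV[R]_n -> V}) :
  exists2 C : R, 0 < C & forall u, `|f u| <= C * `|u|.
Proof.
exists (1 + \sum_i `|f 'e_i|) => [|u]; first by rewrite ltr_wpDr ?sumr_ge0.
rewrite [in leLHS](row_sum_delta u) linear_sum (le_trans (ler_norm_sum _ _ _))//.
apply: (@le_trans _ _ ((\sum_i `|f 'e_i|) * `|u|)); last first.
  by rewrite ler_wpM2r// lerDr.
rewrite mulr_suml; apply: ler_sum => i _.
rewrite linearZ normrZ mulrC ler_wpM2l//.
by rewrite [leRHS]/Num.Def.normr/= mx_normrE; apply/bigmax_geP; right; exists (0, i).
Qed.

Lemma linear_bounded (V : euclideanType R) (W : normedModType R) (f : {linear V -> W}) :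
  exists2 C : R, 0 < C & forall v, `|f v| <= C * `|v|.
Proof.
have [C1 C10 HC1] := v2r_bounded V.
have [C2 C20 HC2] := linear_rV_bounded (f \o r2v).
exists (C2 * C1) => [|v]; first by rewrite mulr_gt0.
have := HC2 (v2r v); rewrite /= v2rK => /le_trans; apply.
by rewrite -mulrA ler_wpM2l ?HC1// ltW.
Qed.

Lemma bound_linear_continuous (V W : normedModType R) (f : {linear V -> W}) (C : R) :
  (forall v, `|f v| <= C * `|v|) -> continuous f.
Proof.
move=> fC; apply/linear_bounded_continuous/linear_boundedP.
near=> r => v; apply: (le_trans (fC v)); by rewrite ler_wpM2r.
Unshelve. all: by end_near. Qed.

Lemma linear_findim_continuous (V : euclideanType R) (W : normedModType R)
  (f : {linear V -> W}) : continuous f.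
Proof. by have [C _ /bound_linear_continuous] := linear_bounded f. Qed.

(** The ball of radius [M] lies in the image under [r2v] of a closed ball of row vectors, which is
    compact by Heine-Borel. *)
Lemma bounded_subset_compact (V : euclideanType R) (M : R) :
  exists2 A : set V, compact A & forall v, `|v| <= M -> A v.
Proof.
have [C C0 HC] := v2r_bounded V.
have [D _ /bound_linear_continuous r2vc] := linear_rV_bounded (@r2v R V).
exists (r2v @` [set u : 'rV[R]_(dim V) | `|u| <= C * M]).
  apply: continuous_compact; first exact: continuous_subspaceT.
  apply: bounded_closed_compact.
    exists (C * M); split; first exact: num_real.
    by move=> N CMN u /= /le_trans; apply; exact: ltW.
  rewrite -[X in closed X]/([set u | [set r | r <= C * M] `|u|]).
  apply: closed_comp => [u _|]; last exact: closed_le.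
  exact: norm_continuous.
move=> v vM; exists (v2r v); rewrite ?v2rK//=.
by rewrite (le_trans (HC v))// ler_wpM2l// ltW.
Qed.

End FiniteDimension.

(** * Variational inequality of the proximal map *)

Section Prox.
Context {R : realType} {V : euclideanType R}.
Implicit Types (h : V -> \bar R) (x p z : V).

Lemma domain_fineK h x : (forall u, -oo < h u)%E -> effective_domain h x ->
  h x = (fine (h x))%:E.
Proof. by move=> hNy hx; rewrite fineK// fin_real// hNy. Qed.

Lemma prox_domain h (t : R) x p : proper_ereal h -> 0 < t ->
  is_prox (fun u => t%:E * h u)%E x p -> effective_domain h p.
Proof.
move=> [hNy [z hz]] t0 /(_ z); rewrite (domain_fineK hNy hz) /effective_domain/=.
have := hNy p; case: (h p) => [r||]//= _.
by rewrite gt0_muley ?lte_fin// leye_eq.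
Qed.

(** First-order optimality without subgradients: the minimizer [p] is compared with
    [s *: z + (1 - s) *: p], convexity is applied, and after division by [s] one lets [s] tend to
    0. *)
Lemma prox_le h (t : R) x p z : proper_ereal h -> convex_ereal h -> 0 < t ->
  is_prox (fun u => t%:E * h u)%E x p -> effective_domain h z ->
  t * (fine (h p) - fine (h z)) <= inner (p - x) (z - p).
Proof.
move=> hproper [_ hconv] t0 hprox hz; have [hNy _] := hproper.
have hp := prox_domain hproper t0 hprox.
set I := inner _ _; set N := `|z - p| ^+ 2.
have N0 : 0 <= N by rewrite exprn_ge0.
suff step (s : R) : 0 < s < 1 ->
    t * (fine (h p) - fine (h z)) <= I + s * (N / 2).
  (* This choice of [s] makes the error [s * (N / 2)] at most [e]; [N + 1] avoids a division by 0
     when [z = p]. *)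
  apply/ler_addgt0Pr => e e0; pose s := Num.min (1 / 2) (e / (N + 1)).
  have s0 : 0 < s by rewrite lt_min divr_gt0// divr_gt0// ltr_wpDl.
  have s1 : s < 1 by rewrite gt_min; apply/orP; left; lra.
  apply: (le_trans (step s _)); first by rewrite s0.
  rewrite lerD2l; apply: (@le_trans _ _ (e / (N + 1) * (N + 1))).
    apply: ler_pM; rewrite ?divr_ge0// ?(ltW s0)//; first by rewrite ge_min lexx orbT.
    by lra.
  by rewrite divfK// gt_eqF// ltr_wpDl.
move=> s01; have /andP[s0 s1] := s01.
have := hconv z p s s01; set w := s *: z + _.
rewrite (domain_fineK hNy hz) (domain_fineK hNy hp) -!EFinM -EFinD => hw.
have dw : effective_domain h w by exact: le_lt_trans hw (ltry _).
have := hprox w; move: hw; rewrite (domain_fineK hNy dw) (domain_fineK hNy hp).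
rewrite -!EFinM -!EFinD !lee_fin.
have -> : w - x = (p - x) - s *: (p - z).
  by rewrite /w scalerBl scale1r scalerBr !opprB !addrA [LHS]addrAC;
     congr (_ - _); rewrite -addrA addrC.
rewrite (sqr_normB (p - x)) normrZ exprMn -normrX ger0_norm ?sqr_ge0//.
rewrite innerZr -[p - z]opprB innerNr normrN -/I -/N => hw hle.
have tw : t * fine (h w) <= t * (s * fine (h z) + (1 - s) * fine (h p)).
  by rewrite ler_pM2l.
rewrite -(ler_pM2l s0); nra.
Qed.

End Prox.

(** The last alternative records that a step below the first trial value is [mu] times a rejected
    one; the lower bound on the step sizes comes from there. *)
Lemma linesearch_spec (R : realType) (X Y : euclideanType R) (K : X -> Y) (Ka : Y -> X)
    (fs : Y -> \bar R) (mu delta beta : R) x0 x1 y1 (tau0 t t' : R) y' :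
    0 < mu < 1 -> 0 < t ->
    linesearch K Ka fs mu delta beta x0 x1 y1 tau0 t t' y' ->
  [/\ trial_step K fs beta x0 x1 y1 tau0 t' y', accept Ka delta beta y1 t' y',
      0 < t' <= t & t' = t \/ exists s y'', t' = mu * s /\ ~ accept Ka delta beta y1 s y''].
Proof.
move=> /andP[mu0 mu1] + ls.
elim: ls => {t t' y'} [t y2 ty acc t0|t y2 t' y2' ty nacc _ ih t0].
  by split=> //; [rewrite t0 lexx | left].
have [tr acc /andP[t'0 t't] alt] := ih (mulr_gt0 mu0 t0).
split=> //.
  by rewrite t'0 (le_trans t't)// ler_piMl// ltW.
by right; case: alt => [->|//]; exists t, y2.
Qed.

(** * One-step energy inequality *)

Section Energy.
Context {R : realType} {X Y : euclideanType R}.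
Variables (K : {linear X -> Y}) (Ka : {linear Y -> X}).
Hypothesis adjK : adjoint_of K Ka.

Lemma three_point {V : euclideanType R} (a b c : V) :
  2 * inner (b - a) (c - b) = `|a - c| ^+ 2 - `|b - c| ^+ 2 - `|b - a| ^+ 2.
Proof.
rewrite !sqr_normB !innerE -!sqr_norm_inner (innerC b a); ring.
Qed.

(** The values of [g] and [fs] enter as plain reals, which leaves only algebra in inner product
    spaces. The inequalities assumed are the prox inequality of [x2] at [xh], of [y2] at [yh], of
    [x1] at [x2] and at [x0], and the linesearch test; [P] and [D] are the primal and dual gaps. *)
Lemma energy_step (beta delta t0 t1 : R) (x0 x1 x2 xh : X) (y1 y2 yh : Y)
    (G0 G1 G2 Gh F2 Fh : R) :
    let th := t1 / t0 in
    let xbar := x1 + th *: (x1 - x0) in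
    let P u G := G - Gh + inner (Ka yh) (u - xh) in
    let D v F := F - Fh - inner (K xh) (v - yh) in
    0 < beta -> 0 < delta -> 0 < t0 -> 0 < t1 ->
    t1 * (G2 - Gh) <= inner (x2 - (x1 - t1 *: Ka y2)) (xh - x2) ->
    (beta * t1) * (F2 - Fh) <= inner (y2 - (y1 + (beta * t1) *: K xbar)) (yh - y2) ->
    t0 * (G1 - G2) <= inner (x1 - (x0 - t0 *: Ka y1)) (x2 - x1) ->
    t0 * (G1 - G0) <= inner (x1 - (x0 - t0 *: Ka y1)) (x0 - x1) ->
    Num.sqrt beta * t1 * `|Ka y2 - Ka y1| <= delta * `|y2 - y1| ->
  `|x2 - xh| ^+ 2 + beta^-1 * `|y2 - yh| ^+ 2 + 2 * (t1 * (1 + th) * P x1 G1)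
    + `|xbar - x1| ^+ 2 + (1 - delta) * (`|xbar - x2| ^+ 2 + beta^-1 * `|y2 - y1| ^+ 2)
    + 2 * (t1 * D y2 F2)
  <= `|x1 - xh| ^+ 2 + beta^-1 * `|y1 - yh| ^+ 2 + 2 * (t1 * th * P x0 G0).
Proof.
move=> th xbar P D b0 d0 t00 t10 h1 h2 h3 h4 acc.
have tht0 : th * t0 = t1 by rewrite /th divfK// gt_eqF.
have th0 : 0 < th by rewrite divr_gt0.
have dE : xbar - x1 = th *: (x1 - x0) by rewrite /xbar addrC addKr.
(* [h3] and [h4] are added with weights [th] and [th ^+ 2], matching
   [x2 - xbar = (x2 - x1) + th *: (x0 - x1)]. *)
have h34 : t1 * ((1 + th) * G1 - G2 - th * G0) <=
    inner ((xbar - x1) + t1 *: Ka y1) (x2 - xbar).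
  have -> : x2 - xbar = (x2 - x1) + th *: (x0 - x1).
    by rewrite /xbar opprD addrA -scalerN opprB.
  have -> : xbar - x1 + t1 *: Ka y1 = th *: (x1 - (x0 - t0 *: Ka y1)).
    by rewrite dE -tht0 -scalerA -scalerDr opprB addrA addrAC.
  rewrite innerZl innerDr innerZr -tht0.
  have := lerD (ler_wpM2l (ltW th0) h3) (ler_wpM2l (ltW (mulr_gt0 th0 th0)) h4).
  set i1 := inner _ (x2 - x1); set i2 := inner _ (x0 - x1); lra.
have h2' : t1 * (F2 - Fh) <= beta^-1 * inner (y2 - y1) (yh - y2)
    - t1 * inner xbar (Ka yh - Ka y2).
  rewrite -linearB -adjK -(ler_pM2l b0) mulrA (le_trans h2)//.
  rewrite opprD addrA (innerDl (y2 - y1)) (innerNl (_ *: _)) innerZl.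
  by rewrite mulrBr [in leRHS]mulrA divff ?gt_eqF// mul1r mulrA.
(* Cauchy-Schwarz, the linesearch test and [2ab <= a^2 + b^2] bound the coupling term. *)
have cross : 2 * (t1 * inner (Ka y2 - Ka y1) (xbar - x2)) <=
    delta * (`|xbar - x2| ^+ 2 + beta^-1 * `|y2 - y1| ^+ 2).
  set u := Ka y2 - Ka y1 in acc *; set v := xbar - x2; set n := `|y2 - y1| in acc *.
  have sb : 0 < Num.sqrt beta by rewrite sqrtr_gt0.
  have tu : t1 * `|u| <= delta * (n / Num.sqrt beta).
    by rewrite mulrA ler_pdivlMr// mulrC mulrA.
  have -> : beta^-1 * n ^+ 2 = (n / Num.sqrt beta) ^+ 2.
    by rewrite expr_div_n sqr_sqrtr 1?ltW// mulrC.
  apply: (@le_trans _ _ (2 * (delta * (n / Num.sqrt beta) * `|v|))).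
    rewrite ler_pM2l//; apply: (@le_trans _ _ (t1 * (`|u| * `|v|))).
      by rewrite ler_pM2l// inner_le_norm.
    by rewrite mulrA ler_wpM2r.
  have := sqr_ge0 (`|v| - n / Num.sqrt beta); nra.
have e1 := three_point x1 x2 xh; have e2 := three_point x1 xbar x2.
have e3 := three_point y1 y2 yh.
(* The linear part of the gap splits at [xbar] with the weights [1 + th] and [- th] that [G1] and
   [G0] carry in [h34], so that [P x1] and [P x0] appear. *)
have qb : inner (Ka yh) xbar = (1 + th) * inner (Ka yh) x1 - th * inner (Ka yh) x0.
  by rewrite /xbar !innerE; ring.
have k1 : inner (x2 - (x1 - t1 *: Ka y2)) (xh - x2) =
    inner (x2 - x1) (xh - x2) + t1 * (inner (Ka y2) xh - inner (Ka y2) x2).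
  by rewrite !innerE; ring.
have k2 : inner (xbar - x1 + t1 *: Ka y1) (x2 - xbar) =
    inner (xbar - x1) (x2 - xbar) + t1 * (inner (Ka y1) x2 - inner (Ka y1) xbar).
  by rewrite !innerE; ring.
have k3 : inner xbar (Ka yh - Ka y2) = inner (Ka yh) xbar - inner (Ka y2) xbar.
  by rewrite innerC !innerE.
have k4 : inner (Ka y2 - Ka y1) (xbar - x2) =
    inner (Ka y2) xbar - inner (Ka y2) x2 - (inner (Ka y1) xbar - inner (Ka y1) x2).
  by rewrite !innerE; ring.
rewrite (distrC x1 x2) in e2.
have -> : D y2 F2 = F2 - Fh - (inner (Ka y2) xh - inner (Ka yh) xh).
  by rewrite /D adjK innerC linearB innerDl innerNl.
have -> : P x1 G1 = G1 - Gh + (inner (Ka yh) x1 - inner (Ka yh) xh).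
  by rewrite /P innerDr innerNr.
have -> : P x0 G0 = G0 - Gh + (inner (Ka yh) x0 - inner (Ka yh) xh).
  by rewrite /P innerDr innerNr.
rewrite k1 in h1; rewrite k2 in h34; rewrite k3 qb in h2'; rewrite k4 in cross.
have e3' : 2 * (beta^-1 * inner (y2 - y1) (yh - y2)) =
    beta^-1 * `|y1 - yh| ^+ 2 - beta^-1 * `|y2 - yh| ^+ 2 - beta^-1 * `|y2 - y1| ^+ 2.
  by rewrite mulrCA e3 !mulrBr.
(* The claim is now twice the sum of [h1], [h2'] and [h34], plus [cross]; the terms in [|x2 - x1|^2]
   cancel between [e1] and [e2]. *)
clear - h1 h2' h34 cross e1 e2 e3'.
lra.
Qed.

End Energy.

(** * Subsequences, lower semicontinuity and monotone energies *)

Section Sequences.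
Context {R : realType}.

Lemma cvg0_sqr_le (V : normedModType R) (u : nat -> V) (a : nat -> R) :
  (forall n, `|u n| ^+ 2 <= a n) -> a @ \oo --> 0 -> u @ \oo --> 0.
Proof.
move=> ua a0; apply/cvgr0Pnorm_lt => e e0.
have e20 : 0 < e ^+ 2 by rewrite exprn_gt0.
move/cvgr0Pnorm_lt: a0 => /(_ _ e20); apply: filterS => n an.
rewrite -(@ltr_pXn2r _ 2)// ?nnegrE// ?ltW//.
exact: le_lt_trans (ua n) (le_lt_trans (ler_norm _) an).
Qed.

(** Subsequences are encoded by index maps with [n <= phi n], not necessarily increasing: limits
    still pass to them, and the indices can be chosen independently of each other. *)
Lemma cvg_geid (phi : nat -> nat) : (forall n, (n <= phi n)%N) -> phi @ \oo --> \oo.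
Proof.
move=> phige A [N _ NA]; exists N => // n /= Nn.
by apply: NA; rewrite /= (leq_trans Nn).
Qed.

Lemma cvg_subseq (T : topologicalType) (u : nat -> T) (phi : nat -> nat) (l : T) :
  (forall n, (n <= phi n)%N) -> u @ \oo --> l -> (fun n => u (phi n)) @ \oo --> l.
Proof. by move=> /cvg_geid phioo; exact: cvg_comp. Qed.

Lemma cluster_subseq (T : pseudoMetricType R) (u : nat -> T) (p : T) :
  cluster (u @ \oo) p ->
  exists2 phi : nat -> nat, (forall n, (n <= phi n)%N) & (fun n => u (phi n)) @ \oo --> p.
Proof.
move=> up.
have /choice[phi phiP] (n : nat) : exists k, (n <= k)%N /\ ball p n.+1%:R^-1 (u k).
  have tail : (u @ \oo) (u @` [set k | (n <= k)%N]) by exists n => // k nk; exists k.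
  have pball : nbhs p (ball p n.+1%:R^-1) by apply: nbhsx_ballx.
  by have [w [[k nk <-] pk]] := up _ _ tail pball; exists k.
exists phi => [n|]; first by have [] := phiP n.
apply/cvg_ballP => e e0; near=> n; have [_] := phiP n; apply: le_ball.
by apply: ltW; near: n; exact: near_infty_natSinv_lt (PosNum e0).
Unshelve. all: by end_near. Qed.

(** Otherwise a real [a] lies strictly between [l] and [h p]; eventually [c n < a] while
    [a < h (u n)], a contradiction. *)
Lemma lsc_le (V : topologicalType) (h : V -> \bar R) (u : nat -> V) (c : nat -> R)
    (p : V) (l : R) : lower_semicontinuous h ->
  u @ \oo --> p -> c @ \oo --> l -> (forall n, (h (u n) <= (c n)%:E)%E) -> (h p <= l%:E)%E.
Proof.
move=> hlsc up cl hc; rewrite leNgt; apply/negP => lh.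
have [a la ah] : exists2 a, l < a & (a%:E < h p)%E.
  move: lh; case: (h p) => [r||//].
    by rewrite lte_fin => lr; exists ((l + r) / 2); rewrite ?lte_fin; lra.
  by move=> _; exists (l + 1); [lra | exact: ltry].
have [A pA Aa] := hlsc _ _ ah.
have [n [cna]] : exists n, c n < a /\ A (u n).
  by near \oo => n; exists n; split; near: n; [exact: (cvgr_lt _ cl) | exact: up].
by move=> /Aa /lt_le_trans/(_ (hc n)); rewrite lte_fin ltNge (ltW cna).
Unshelve. all: by end_near. Qed.

(** Monotone convergence gives the limit of [E], and [gap n] is squeezed between 0 and
    [E n - E n.+1]. *)
Lemma decreasing_gap_cvg0 (E gap : nat -> R) :
  (forall n, 0 <= E n) -> (forall n, 0 <= gap n) -> (forall n, E n.+1 + gap n <= E n) ->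
  cvgn E /\ gap @ \oo --> 0.
Proof.
move=> E0 gap0 EE.
have cE : cvgn E.
  apply: nonincreasing_is_cvgn; last by exists 0 => _ [n _ <-].
  apply/nonincreasing_seqP => n; apply: le_trans (EE n); rewrite lerDl; exact: gap0.
split=> //.
have dE : (fun n => E n - E n.+1) @ \oo --> (0 : R).
  rewrite -(subrr (limn E)); apply: cvgB => //.
  by rewrite (cvg_shiftS E).
apply: (squeeze_cvgr _ (@cvg_cst _ (0 : R) _ _ _) dE).
by apply: nearW => n; rewrite gap0 lerBrDl EE.
Qed.

End Sequences.

(** * Step sizes, domains and prox inequalities along the iterates *)

Section PDALConvergence.
Context {R : realType} {X Y : euclideanType R}.
Variables (K : {linear X -> Y}) (Ka : {linear Y -> X}) (g : X -> \bar R) (fs : Y -> \bar R).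
Hypotheses (adjK : adjoint_of K Ka).
Hypotheses (g_proper : proper_ereal g) (g_convex : convex_ereal g).
Hypotheses (fs_proper : proper_ereal fs) (fs_convex : convex_ereal fs).
Variables (mu delta beta : R).
Hypotheses (mu01 : 0 < mu < 1) (delta01 : 0 < delta < 1) (beta_gt0 : 0 < beta).
Variables (x : nat -> X) (y : nat -> Y) (tau theta : nat -> R).
Hypothesis xyP : is_PDAL K Ka g fs mu delta beta x y tau theta.

(** With this indexing, [xbar k] is the extrapolated point of iteration k+1. *)
Let xbar k := x k.+1 + theta k.+1 *: (x k.+1 - x k).

Lemma tau_gt0 k : 0 < tau k.
Proof.
elim: k => [|k tk]; first exact: PDAL_tau0 xyP.
have [t [/andP[kt _]]] := PDAL_linesearch xyP k.
by move=> /(linesearch_spec mu01 (lt_le_trans tk kt))[_ _ /andP[]].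
Qed.

Lemma theta_gt0 k : 0 < theta k.
Proof.
case: k => [|k]; first by rewrite (PDAL_theta0 xyP).
by rewrite (PDAL_theta xyP) divr_gt0 ?tau_gt0.
Qed.

(** The third clause is the squared upper bound on the trial value divided by [tau k]; it is what
    lets the gap terms of consecutive energies telescope. *)
Lemma PDAL_step k : [/\ trial_step K fs beta (x k) (x k.+1) (y k.+1) (tau k) (tau k.+1) (y k.+2),
  accept Ka delta beta (y k.+1) (tau k.+1) (y k.+2),
  tau k.+1 * theta k.+1 <= tau k * (1 + theta k) &
  tau k <= tau k.+1 \/
    exists s y'', tau k.+1 = mu * s /\ ~ accept Ka delta beta (y k.+1) s y''].
Proof.
have tk := tau_gt0 k.
have [t [/andP[kt tk']]] := PDAL_linesearch xyP k.
move=> /(linesearch_spec mu01 (lt_le_trans tk kt))[tr ac /andP[t0 tt] alt].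
split => //; last by case: alt => [->|]; [left|right].
rewrite (PDAL_theta xyP) mulrA ler_pdivrMr//.
have h := theta_gt0 k; have h1 : 0 <= 1 + theta k by rewrite addr_ge0 ?ltW.
have : tau k.+1 <= tau k * Num.sqrt (1 + theta k) by exact: le_trans tk'.
move/(lerXn2r 2 (ltW t0) (mulr_ge0 (ltW tk) (sqrtr_ge0 _))).
by rewrite exprMn sqr_sqrtr// !expr2 mulrAC.
Qed.

(** If [L] bounds [Ka], every step up to [delta / (Num.sqrt beta * L)] passes the test, so a
    rejected step exceeds this value and its reduction exceeds [mu] times it. *)
Lemma tau_lower_bound : exists2 c, 0 < c & forall k, c <= tau k.
Proof.
have [L L0 KaL] := linear_bounded Ka.
have /andP[mu0 mu1] := mu01; have /andP[d0 d1] := delta01.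
have sb : 0 < Num.sqrt beta by rewrite sqrtr_gt0.
have bL : 0 < Num.sqrt beta * L by rewrite mulr_gt0.
exists (Num.min (tau 0%N) (mu * (delta / (Num.sqrt beta * L)))).
  by rewrite lt_min tau_gt0 mulr_gt0// divr_gt0.
elim=> [|k ih]; first by rewrite ge_min lexx.
have [_ _ _ [/(le_trans ih)//|[s [y'' [ts nacc]]]]] := PDAL_step k.
rewrite ge_min; apply/orP; right; rewrite ts ler_pM2l// leNgt; apply/negP => sd.
apply: nacc; rewrite /accept -linearB.
(* The sign of the rejected step is recovered from [tau k.+1 = mu * s]. *)
have s0 : 0 <= s by rewrite -(pmulr_rge0 _ mu0) -ts ltW// tau_gt0.
apply: (@le_trans _ _ (Num.sqrt beta * s * (L * `|y'' - y k.+1|))).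
  by rewrite ler_wpM2l ?KaL// mulr_ge0// ltW.
by rewrite mulrA ler_wpM2r// mulrAC mulrC -ler_pdivlMr// ltW.
Qed.

(** The starting points x^0 and y^1 are arbitrary, so membership in the domains begins with x^1 and,
    below, with y^2. *)
Lemma PDAL_x_domain k : effective_domain g (x k.+1).
Proof. exact: prox_domain (tau_gt0 k) (PDAL_x xyP k). Qed.

Lemma PDAL_y_domain k : effective_domain fs (y k.+2).
Proof.
have [tr _ _ _] := PDAL_step k.
exact: prox_domain (mulr_gt0 beta_gt0 (tau_gt0 _)) tr.
Qed.

Lemma PDAL_x_le k u : effective_domain g u ->
  tau k * (fine (g (x k.+1)) - fine (g u)) <=
    inner (x k.+1 - (x k - tau k *: Ka (y k.+1))) (u - x k.+1).
Proof. exact: prox_le (tau_gt0 k) (PDAL_x xyP k). Qed.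

Lemma PDAL_y_le k v : effective_domain fs v ->
  beta * tau k.+1 * (fine (fs (y k.+2)) - fine (fs v)) <=
    inner (y k.+2 - (y k.+1 + (beta * tau k.+1) *: K (xbar k))) (v - y k.+2).
Proof.
have [tr _ _ _] := PDAL_step k.
rewrite /xbar (PDAL_theta xyP).
exact: prox_le (mulr_gt0 beta_gt0 (tau_gt0 _)) tr.
Qed.

(** Passes to real-valued inequalities on the domains; outside them the value +oo makes the extended
    inequalities trivial. *)
Lemma saddle_pointP (zh : X * Y) : saddle_point K Ka g fs zh <->
  [/\ effective_domain g zh.1, effective_domain fs zh.2,
    (forall u, effective_domain g u ->
       0 <= fine (g u) - fine (g zh.1) + inner (Ka zh.2) (u - zh.1)) &
    (forall v, effective_domain fs v ->
       0 <= fine (fs v) - fine (fs zh.2) - inner (K zh.1) (v - zh.2))].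
Proof.
have [gNy _] := g_proper; have [fNy _] := fs_proper.
split=> -[dg df hg hf]; split=> // u.
- move=> du; have := hg u.
  by rewrite (domain_fineK gNy du) (domain_fineK gNy dg) -EFinB -EFinD lee_fin.
- move=> du; have := hf u.
  by rewrite (domain_fineK fNy du) (domain_fineK fNy df) -!EFinB lee_fin.
- rewrite (domain_fineK gNy dg).
  have [du|] := boolP (g u < +oo)%E.
    by rewrite (domain_fineK gNy du) -EFinB -EFinD lee_fin hg.
  by rewrite ltey negbK => /eqP ->; rewrite -EFinN !addye ?leey.
- rewrite (domain_fineK fNy df).
  have [du|] := boolP (fs u < +oo)%E.
    by rewrite (domain_fineK fNy du) -!EFinB lee_fin hf.
  by rewrite ltey negbK => /eqP ->; rewrite -EFinN !addye ?leey.
Qed.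

(** * Lyapunov analysis around a fixed saddle point *)

Section Lyapunov.
Variable zh : X * Y.
Hypothesis zhP : saddle_point K Ka g fs zh.

(** Since [fine] sends +oo to 0, this is the primal gap only on the domain of [g]. *)
Let P u := fine (g u) - fine (g zh.1) + inner (Ka zh.2) (u - zh.1).

Definition energy k := `|x k.+1 - zh.1| ^+ 2 + beta^-1 * `|y k.+1 - zh.2| ^+ 2
  + 2 * (tau k * (1 + theta k) * P (x k)).

Definition energy_gap k := `|xbar k - x k.+1| ^+ 2
  + (1 - delta) * (`|xbar k - x k.+2| ^+ 2 + beta^-1 * `|y k.+2 - y k.+1| ^+ 2).

Lemma energy_gap_ge0 k : 0 <= energy_gap k.
Proof.
have /andP[_ d1] := delta01.
rewrite addr_ge0 ?sqr_ge0// mulr_ge0 ?subr_ge0 ?(ltW d1)//.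
by rewrite addr_ge0 ?sqr_ge0// mulr_ge0 ?sqr_ge0// invr_ge0 ltW.
Qed.

(* Starts at index 1 because g (x 0) may be +oo. *)
Lemma energy_decreasing k : energy k.+2 + energy_gap k.+1 <= energy k.+1.
Proof.
have [dg df hg hf] := (saddle_pointP zh).1 zhP; have /andP[d0 d1] := delta01.
have [_ acc tth _] := PDAL_step k.+1.
have := @energy_step _ _ _ K Ka adjK beta delta (tau k.+1) (tau k.+2)
  (x k.+1) (x k.+2) (x k.+3) zh.1 (y k.+2) (y k.+3) zh.2
  (fine (g (x k.+1))) (fine (g (x k.+2))) (fine (g (x k.+3))) (fine (g zh.1))
  (fine (fs (y k.+3))) (fine (fs zh.2)) beta_gt0 d0 (tau_gt0 _) (tau_gt0 _)
  (PDAL_x_le k.+2 dg) _ (PDAL_x_le k.+1 (PDAL_x_domain _)) (PDAL_x_le k.+1 (PDAL_x_domain _)) acc.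
rewrite -(PDAL_theta xyP) => /(_ (PDAL_y_le k.+1 df)).
have := hf _ (PDAL_y_domain k.+1); set D := fine (fs _) - _ - _ => D0.
have tD : 0 <= tau k.+2 * D by rewrite mulr_ge0// ltW// tau_gt0.
(* Multiplied by the nonnegative gap at [x k.+1], the step-size inequality turns the coefficient
   [tau k.+2 * theta k.+2] into the one in [energy k.+1]; the dual gap term is nonnegative and is
   dropped. *)
have := ler_wpM2r (hg _ (PDAL_x_domain k)) tth.
rewrite /energy /energy_gap -/(P _) -/(P _) -/(xbar _); lra.
Qed.

Lemma energy_ge k : `|x k.+2 - zh.1| ^+ 2 + beta^-1 * `|y k.+2 - zh.2| ^+ 2 <= energy k.+1.
Proof.
have [_ _ hg _] := (saddle_pointP zh).1 zhP.
rewrite lerDl mulr_ge0// mulr_ge0 ?hg//; last exact: PDAL_x_domain.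
by rewrite mulr_ge0 ?addr_ge0// ltW// ?tau_gt0// theta_gt0.
Qed.

Lemma energy_ge0 k : 0 <= energy k.+1.
Proof.
by apply: le_trans (energy_ge k); rewrite addr_ge0 ?sqr_ge0// mulr_ge0 ?sqr_ge0// invr_ge0 ltW.
Qed.

Lemma energy_cvg : cvgn (fun k => energy k.+1).
Proof.
by have [] := decreasing_gap_cvg0 energy_ge0 (fun k => energy_gap_ge0 k.+1) energy_decreasing.
Qed.

Lemma energy_gap_cvg0 : energy_gap @ \oo --> 0.
Proof.
have [_] := decreasing_gap_cvg0 energy_ge0 (fun k => energy_gap_ge0 k.+1) energy_decreasing.
by rewrite (cvg_shiftS energy_gap).
Qed.

Lemma xbar_diff_cvg0 : (fun k => xbar k - x k.+1) @ \oo --> 0.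
Proof.
apply: (cvg0_sqr_le _ energy_gap_cvg0) => k; have /andP[_ d1] := delta01.
rewrite lerDl mulr_ge0 ?subr_ge0 ?(ltW d1)//.
by rewrite addr_ge0 ?sqr_ge0// mulr_ge0 ?sqr_ge0// invr_ge0 ltW.
Qed.

(** The increment is the difference of two vanishing vectors, [xbar k - x k.+1] and
    [xbar k - x k.+2], rather than a quotient by [theta]. *)
Lemma x_diff_cvg0 : (fun k => x k.+1 - x k) @ \oo --> 0.
Proof.
have /andP[_ d1] := delta01; have d1' : 0 < 1 - delta by rewrite subr_gt0.
rewrite -(cvg_shiftS (fun k => x k.+1 - x k)).
have h : (fun k => xbar k - x k.+2) @ \oo --> 0.
  apply: (@cvg0_sqr_le _ _ _ (fun k => (1 - delta)^-1 * energy_gap k)) => [k|].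
    rewrite ler_pdivlMl// /energy_gap ler_wpDl ?sqr_ge0// ler_pM2l//.
    by rewrite lerDl mulr_ge0 ?sqr_ge0// invr_ge0 ltW.
  by rewrite -(mulr0 (1 - delta)^-1); apply: cvgMr; exact: energy_gap_cvg0.
have -> : [sequence x k.+2 - x k.+1]_k =
    (fun k => (xbar k - x k.+1) - (xbar k - x k.+2)).
  by apply/funext => k /=; rewrite opprB [RHS]addrC addrA subrK.
by rewrite -(subrr 0); apply: cvgB => //; exact: xbar_diff_cvg0.
Qed.

Lemma y_diff_cvg0 : (fun k => y k.+2 - y k.+1) @ \oo --> 0.
Proof.
have /andP[_ d1] := delta01; have d1' : 0 < 1 - delta by rewrite subr_gt0.
apply: (@cvg0_sqr_le _ _ _ (fun k => beta * ((1 - delta)^-1 * energy_gap k))) => [k|].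
  rewrite -ler_pdivrMl// ler_pdivlMl// /energy_gap ler_wpDl ?sqr_ge0// ler_pM2l//.
  by rewrite lerDr sqr_ge0.
rewrite -(mulr0 beta) -(mulr0 (1 - delta)^-1).
by do 2 apply: cvgMr; exact: energy_gap_cvg0.
Qed.

Lemma PDAL_bounded : exists M, forall k, `|x k.+1| <= M /\ `|y k.+1| <= M.
Proof.
have le_sqr (a b : R) : 0 <= a -> a ^+ 2 <= b -> a <= 1 + b.
  by move=> a0 ab; have := sqr_ge0 (a - 1); nra.
have eE k : energy k.+1 <= energy 1.
  elim: k => // k; apply: le_trans; apply: le_trans (energy_decreasing k).
  by rewrite lerDl energy_gap_ge0.
have e0 := energy_ge0 0.
have b0 : 0 <= beta^-1 by rewrite invr_ge0 ltW.
have be0 : 0 <= beta * energy 1 by rewrite mulr_ge0// ltW.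
(* The energy bound reaches the iterates only from index 2 on, so [x 1] and [y 1] are added
   separately. *)
exists (`|x 1%N| + `|y 1%N| + `|zh.1| + `|zh.2| + (1 + energy 1) + (1 + beta * energy 1)).
have := (normr_ge0 (x 1%N), normr_ge0 (y 1%N), normr_ge0 zh.1, normr_ge0 zh.2).
move=> [[[]]] ? ? ? ?; case=> [|k]; first by split; lra.
have hk := le_trans (energy_ge k) (eE k).
have hx : `|x k.+2 - zh.1| <= 1 + energy 1.
  apply: le_sqr => //; apply: le_trans hk.
  by rewrite lerDl mulr_ge0 ?sqr_ge0.
have hy : `|y k.+2 - zh.2| <= 1 + beta * energy 1.
  apply: le_sqr => //; rewrite -ler_pdivrMl//; apply: le_trans hk.
  by rewrite lerDr sqr_ge0.
have := ler_normD (x k.+2 - zh.1) zh.1; have := ler_normD (y k.+2 - zh.2) zh.2.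
by rewrite !subrK; split; lra.
Qed.

(** Steps bounded below have bounded inverses; this allows division of the prox inequalities by the
    step size before passing to the limit. *)
Lemma scale_tauV_cvg0 (V : normedModType R) (v : nat -> V) (psi : nat -> nat) :
  v @ \oo --> 0 -> (fun n => (tau (psi n))^-1 *: v n) @ \oo --> 0.
Proof.
have [c c0 ctau] := tau_lower_bound => v0.
apply: (@cvg0_sqr_le _ _ _ (fun n => c^-1 ^+ 2 * (`|v n| * `|v n|))) => [n|].
  rewrite normrZ exprMn -expr2 ler_wpM2r ?sqr_ge0//.
  rewrite lerXn2r ?nnegrE ?normr_ge0 ?invr_ge0 ?(ltW c0)//.
  by rewrite gtr0_norm ?invr_gt0 ?tau_gt0// lef_pV2 ?posrE ?tau_gt0.
rewrite -(mulr0 (c^-1 ^+ 2)); apply: cvgMr.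
rewrite -[X in _ --> X](mulr0 0); have n0 : (fun n => `|v n|) @ \oo --> 0.
  by rewrite -(@normr0 _ V); exact: cvg_norm.
exact: cvgM.
Qed.

(** The saddle point [zh] may differ from the limit: it makes the increments vanish and supplies
    points of both domains. *)
Lemma limit_saddle (phi : nat -> nat) (xs : X) (ys : Y) : lower_semicontinuous g ->
  lower_semicontinuous fs -> (forall n, (n <= phi n)%N) ->
  (fun n => x (phi n).+1) @ \oo --> xs -> (fun n => y (phi n).+1) @ \oo --> ys ->
  saddle_point K Ka g fs (xs, ys).
Proof.
move=> glsc fslsc phige xxs yys.
have [dg df _ _] := (saddle_pointP zh).1 zhP.
have [gNy _] := g_proper; have [fNy _] := fs_proper.
have dx := cvg_subseq phige x_diff_cvg0.
have dy := cvg_subseq phige y_diff_cvg0.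
have xbxs : (fun n => xbar (phi n)) @ \oo --> xs.
  have -> : (fun n => xbar (phi n)) =
      (fun n => xbar (phi n) - x (phi n).+1 + x (phi n).+1).
    by apply/funext => n /=; rewrite subrK.
  rewrite -[xs]add0r; apply: cvgD xxs; exact: (cvg_subseq phige xbar_diff_cvg0).
have yys2 : (fun n => y (phi n).+2) @ \oo --> ys.
  have -> : (fun n => y (phi n).+2) =
      (fun n => y (phi n).+2 - y (phi n).+1 + y (phi n).+1).
    by apply/funext => n /=; rewrite subrK.
  by rewrite -[ys]add0r; apply: cvgD yys.
have gle u : effective_domain g u ->
    (g xs <= (fine (g u) + inner (Ka ys) (u - xs))%:E)%E.
  (* The sequence [c] is the bound on [g (x (phi n).+1)] given by the prox inequality divided by
     [tau (phi n)]. *)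
  move=> du; apply: (lsc_le glsc xxs (c := fun n => fine (g u) +
    inner ((tau (phi n))^-1 *: (x (phi n).+1 - x (phi n)) + Ka (y (phi n).+1))
      (u - x (phi n).+1))) => [|n].
    apply: cvgD; first exact: cvg_cst.
    apply: cvg_inner; last by apply: cvgB => //; exact: cvg_cst.
    rewrite -[Ka ys]add0r; apply: cvgD; first exact: scale_tauV_cvg0.
    by apply: continuous_cvg => //; exact: linear_findim_continuous.
  rewrite (domain_fineK gNy (PDAL_x_domain _)) lee_fin -lerBlDl.
  rewrite -(ler_pM2l (tau_gt0 (phi n))) (le_trans (PDAL_x_le _ du))//.
  rewrite -innerZl scalerDr scalerA divff ?gt_eqF ?tau_gt0// scale1r.
  by rewrite opprB addrA [in leRHS]addrAC addrAC.
have fle v : effective_domain fs v ->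
    (fs ys <= (fine (fs v) - inner (K xs) (v - ys))%:E)%E.
  move=> dv; apply: (lsc_le fslsc yys2 (c := fun n => fine (fs v) +
    inner (beta^-1 *: ((tau (phi n).+1)^-1 *: (y (phi n).+2 - y (phi n).+1))
      - K (xbar (phi n))) (v - y (phi n).+2))) => [|n].
    apply: cvgD; first exact: cvg_cst.
    rewrite -innerNl; apply: cvg_inner; last by apply: cvgB => //; exact: cvg_cst.
    rewrite -[- K xs]add0r; apply: cvgB.
      by rewrite -(scaler0 _ beta^-1); apply: cvgZr; exact: (scale_tauV_cvg0 (fun n => (phi n).+1)).
    by apply: continuous_cvg => //; exact: linear_findim_continuous.
  rewrite (domain_fineK fNy (PDAL_y_domain _)) lee_fin -lerBlDl.
  have bt : 0 < beta * tau (phi n).+1 by rewrite mulr_gt0 ?tau_gt0.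
  rewrite -(ler_pM2l bt) (le_trans (PDAL_y_le _ dv))//.
  rewrite -innerZl scalerBr !scalerA [X in X *: (y _ - _)](_ : _ = 1).
    by rewrite scale1r opprD addrA.
  by field; rewrite !gt_eqF ?tau_gt0.
(* Finiteness at the limit follows by testing the limit inequalities at [zh]. *)
have dxs : effective_domain g xs by exact: le_lt_trans (gle _ dg) (ltry _).
have dys : effective_domain fs ys by exact: le_lt_trans (fle _ df) (ltry _).
apply/saddle_pointP; split=> //= [u du|v dv].
  by have := gle _ du; rewrite (domain_fineK gNy dxs) lee_fin; lra.
by have := fle _ dv; rewrite (domain_fineK fNy dys) lee_fin; lra.
Qed.

(** Here [zh] is itself the limit along [phi]: the energy centred at it converges and tends to 0
    along [phi], hence tends to 0. *)
Lemma PDAL_cvg (phi : nat -> nat) :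
  {within effective_domain g, continuous g} -> has_ubound (range tau) ->
  (forall n, (n <= phi n)%N) ->
  (fun n => x (phi n).+1) @ \oo --> zh.1 -> (fun n => y (phi n).+1) @ \oo --> zh.2 ->
  (fun k => x k.+1) @ \oo --> zh.1 /\ (fun k => y k.+1) @ \oo --> zh.2.
Proof.
move=> gcont [T Ttau] phige xxh yyh.
have {}Ttau k : tau k <= T by apply: Ttau; exists k.
have [c c0 ctau] := tau_lower_bound.
have [dg df hg hf] := (saddle_pointP zh).1 zhP.
have [gNy _] := g_proper; have b0 : 0 <= beta^-1 by rewrite invr_ge0 ltW.
have gx : (fun n => fine (g (x (phi n).+1))) @ \oo --> fine (g zh.1).
  apply: fine_cvg; rewrite -(domain_fineK gNy dg).
  (* Continuity relative to the domain suffices because every [x (phi n).+1] lies in it. *)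
  have gzh := (subspace_continuousP _ _).1 gcont _ dg.
  apply: (@cvg_comp _ _ _ (fun n => x (phi n).+1) g _ _ _ _ gzh).
  move=> A gA.
  have := xxh _ gA : \forall n \near \oo, effective_domain g (x (phi n).+1) -> A (x (phi n).+1).
  by apply: (@filterS _ \oo) => n; apply; exact: PDAL_x_domain.
have P0 : (fun n => P (x (phi n).+1)) @ \oo --> 0.
  have -> : 0 = P zh.1 by rewrite /P !subrr innerC inner0l addr0.
  apply: cvgD; first by apply: cvgB gx _; exact: cvg_cst.
  by apply: cvg_inner; [exact: cvg_cst | apply: cvgB xxh _; exact: cvg_cst].
have sq0 (V : normedModType R) (v w : nat -> V) (l : V) :
    v @ \oo --> l -> (fun n => w n - v n) @ \oo --> 0 ->
    (fun n => `|w n - l| ^+ 2) @ \oo --> (0 : R).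
  move=> vl wv.
  have wl : (fun n => `|w n - l|) @ \oo --> (0 : R).
    rewrite -(@normr0 _ V); apply: cvg_norm.
    have -> : (fun n => w n - l) = (fun n => (w n - v n) + (v n - l)).
      by apply/funext => n; rewrite addrA subrK.
    rewrite -(addr0 0) -[X in _ + X](subrr l).
    by apply: cvgD wv _; apply: cvgB vl _; exact: cvg_cst.
  have -> : (fun n => `|w n - l| ^+ 2) = (fun n => `|w n - l| * `|w n - l|).
    by apply/funext => n; rewrite expr2.
  by rewrite -[X in _ --> X](mulr0 0); exact: cvgM.
have T0 : 0 < T := lt_le_trans c0 (le_trans (ctau 0) (Ttau 0)).
(* The lower bound [c] on the steps and the upper bound [T] give [theta k.+1 <= T / c], so the
   weights of the gap stay bounded. *)
have coef k : 0 <= tau k.+1 * (1 + theta k.+1) <= T * (1 + T / c).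
  have th0 := theta_gt0 k.+1; have t0 := tau_gt0 k.+1.
  have thT : theta k.+1 <= T / c.
    rewrite (PDAL_theta xyP); apply: ler_pM; rewrite ?Ttau ?invr_ge0 ?(ltW (tau_gt0 _))//.
    by rewrite lef_pV2 ?posrE ?tau_gt0.
  rewrite mulr_ge0 ?(ltW t0) ?addr_ge0 ?(ltW th0)//=.
  by apply: ler_pM; rewrite ?(ltW t0) ?Ttau ?addr_ge0 ?(ltW th0) ?lerD2l.
have tP0 : (fun n => tau (phi n).+1 * (1 + theta (phi n).+1) * P (x (phi n).+1))
    @ \oo --> 0.
  have h : (fun n => T * (1 + T / c) * P (x (phi n).+1)) @ \oo --> 0.
    by rewrite -(mulr0 (T * (1 + T / c))); exact: cvgMr.
  apply: (squeeze_cvgr _ (@cvg_cst _ (0 : R) _ _ _) h); apply: nearW => n.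
  have /andP[k0 kT] := coef (phi n); have hP := hg _ (PDAL_x_domain (phi n)).
  by rewrite mulr_ge0//= ler_wpM2r.
(* [energy (phi n).+1] involves the iterates of index [(phi n).+2]; vanishing increments give them
   the same limits. *)
have ephi : (fun n => energy (phi n).+1) @ \oo --> 0.
  have -> : 0 = 0 + beta^-1 * 0 + 2 * 0 :> R by rewrite !mulr0 !addr0.
  apply: cvgD; last exact: cvgMr.
  have dx : (fun k => x k.+2 - x k.+1) @ \oo --> 0.
    by have := x_diff_cvg0; rewrite -(cvg_shiftS (fun k => x k.+1 - x k)).
  apply: cvgD; first exact: sq0 xxh (cvg_subseq phige dx).
  by apply: cvgMr; exact: sq0 yyh (cvg_subseq phige y_diff_cvg0).
have e0 : (fun k => energy k.+1) @ \oo --> 0.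
  rewrite -(cvg_unique (@norm_hausdorff _ R) (cvg_subseq phige energy_cvg) ephi).
  exact: energy_cvg.
have to_lim (V : normedModType R) (v : nat -> V) (l : V) :
    (fun k => v k.+2 - l) @ \oo --> 0 -> (fun k => v k.+1) @ \oo --> l.
  move=> vl; rewrite -(cvg_shiftS (fun k => v k.+1)).
  have -> : [sequence v n.+2]_n = (fun n => v n.+2 - l + l).
    by apply/funext => n /=; rewrite subrK.
  suff : (fun n => v n.+2 - l + l) @ \oo --> 0 + l by rewrite add0r.
  by apply: cvgD vl _; exact: cvg_cst.
split; apply: to_lim.
  apply: (cvg0_sqr_le _ e0) => k; apply: le_trans (energy_ge k).
  by rewrite lerDl mulr_ge0 ?sqr_ge0.
apply: (@cvg0_sqr_le _ _ _ (fun k => beta * energy k.+1)) => [k|].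
  by rewrite -ler_pdivrMl//; apply: le_trans (energy_ge k); rewrite lerDr sqr_ge0.
by rewrite -(mulr0 beta); exact: cvgMr.
Qed.

End Lyapunov.
End PDALConvergence.

Theorem theorem1 (R : realType) (X Y : euclideanType R)
  (K : {linear X -> Y}) (Ka : {linear Y -> X}) (adjK : adjoint_of K Ka)
  (g : X -> \bar R)
  (g_proper : proper_ereal g) (g_convex : convex_ereal g)
  (g_lsc : lower_semicontinuous g)
  (f : Y -> \bar R) (f_convex : convex_ereal f) (f_lsc : lower_semicontinuous f)
  (fs_proper : proper_ereal (fenchel_conjugate f)) (fs_convex : convex_ereal (fenchel_conjugate f))
  (fs_lsc : lower_semicontinuous (fenchel_conjugate f))
  (saddle_exists : exists z, saddle_point K Ka g (fenchel_conjugate f) z)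
  (mu delta beta : R)
  (mu01 : 0 < mu < 1) (delta01 : 0 < delta < 1) (beta_gt0 : 0 < beta)
  (x : nat -> X) (y : nat -> Y) (tau theta : nat -> R)
  (xyP : is_PDAL K Ka g (fenchel_conjugate f) mu delta beta x y tau theta) :
  let z : nat -> X * Y := fun k => (x k.+1, y k.+1) in
  [/\ bounded_fun z,
      cluster (z @ \oo) `<=` saddle_point K Ka g (fenchel_conjugate f)
    & {within effective_domain g, continuous g} -> has_ubound (range tau) ->
      exists zh : X * Y,
        saddle_point K Ka g (fenchel_conjugate f) zh /\ z @ \oo --> zh].

Proof.
move=> z; have [zh0 zh0P] := saddle_exists.
have [M HM] := PDAL_bounded adjK g_proper g_convex fs_proper fs_convex mu01 delta01
  beta_gt0 xyP zh0P.
(* Only the first saddle point [zh0] is available at this stage; it serves to show that each cluster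
   point is a saddle point. *)
have clus p : cluster (z @ \oo) p -> exists phi : nat -> nat,
    [/\ forall n, (n <= phi n)%N, (fun n => x (phi n).+1) @ \oo --> p.1,
        (fun n => y (phi n).+1) @ \oo --> p.2
      & saddle_point K Ka g (fenchel_conjugate f) p].
  move=> /cluster_subseq[phi phige zp].
  have xp : (fun n => x (phi n).+1) @ \oo --> p.1.
    by apply: (cvg_comp (fun n => z (phi n)) fst zp); exact: cvg_fst.
  have yp : (fun n => y (phi n).+1) @ \oo --> p.2.
    by apply: (cvg_comp (fun n => z (phi n)) snd zp); exact: cvg_snd.
  exists phi; split => //; case: p xp yp {zp} => xs ys /= xp yp.
  exact: (limit_saddle adjK g_proper g_convex fs_proper fs_convex mu01 delta01
    beta_gt0 xyP zh0P g_lsc fs_lsc phige xp yp).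
split.
- exists M; split; first exact: num_real.
  move=> N /ltW MN k _ /=; have [xM yM] := HM k.
  by rewrite prod_normE ge_max !(le_trans _ MN).
- by move=> p /clus[phi []].
- move=> gcont tau_ub.
  have [A Ac HA] := bounded_subset_compact X M.
  have [B Bc HB] := bounded_subset_compact Y M.
  have zAB : (z @ \oo) (A `*` B).
    by exists 0%N => // k _; have [xM yM] := HM k; split; [exact: HA | exact: HB].
  (* The iterates stay in a compact product, so a cluster point exists; the Lyapunov analysis is
     then repeated with it as centre. *)
  have [p [_ /clus[phi [phige xp yp pP]]]] := compact_setX Ac Bc _ zAB.
  exists p; split=> //.
  have [xc yc] := PDAL_cvg adjK g_proper g_convex fs_proper fs_convex mu01 delta01
    beta_gt0 xyP pP gcont tau_ub phige xp yp.
  by case: p xc yc {xp yp pP} => xs ys /= xc yc; exact: cvg_pair.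
Qed.
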